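(* Let $\alpha,\beta\in K_{semi}(\mathcal{S})$ and let $k$ be a positive integer. If $k\alpha\leq k\beta$, then $\alpha\leq_0\beta$.
   Context: $\mathcal{S}=(S;\dots)$ is a first-order structure; ''definable'' means definable with parameters; $\mathrm{Def}(\mathcal{S})$ is the collection of definable subsets of the powers $S^n$. A fixed collection of isomorphisms $\mathcal{I}_n$ of definable bijections $S^n\to S^n$, closed under composition and inverses, is given. For definable $X,Y$, $X\simeq Y$ means there is a finite definable partition $\{X_i\}$ of $X$ and isomorphisms $f_i$ with the $f_i(X_i)$ pairwise disjoint and $\bigcup_i f_i(X_i)=Y$. $K_{semi}(\mathcal{S})=(\mathrm{Def}(\mathcal{S})/_{\simeq};0,+)$ is the commutative monoid with $0=\emptyset/_{\simeq}$ and $+$ induced by disjoint union. Preorder: $\alpha\leq\beta$ iff there is $\gamma$ with $\alpha+\gamma=\beta$; $k\alpha$ is the $k$-fold sum. For $m>0$, $\alpha\leq_m\beta$ means there are positive integers $p,q$ with $m\leq p/q$ and $p\alpha\leq q\beta$. $\alpha\leq_0\beta$ means for every $m>0$ there are $\alpha',\alpha''\in K_{semi}$ with $\alpha'+\alpha''=\alpha$, $\alpha'\leq_m\alpha$ and $\alpha''\leq\beta$. *)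

(* Defs.v *)
From HB Require Import structures.
From mathcomp Require Import all_boot all_order all_algebra.
From mathcomp Require Import boolp classical_sets functions.
From Stdlib Require Eqdep_dec.

Set Implicit Arguments.
Unset Strict Implicit.
Unset Printing Implicit Defensive.

Local Open Scope classical_set_scope.

Record signature := Signature {
  fsym : Type;
  farity : fsym -> nat;
  rsym : Type;
  rarity : rsym -> nat }.

(* [term L k] and [formula L k]: free variables indexed by ['I_k]; the variable
   bound by [FEx] is variable [ord0] of the body (de Bruijn). *)
Inductive term (L : signature) (k : nat) : Type :=
| TVar of 'I_k
| TApp (f : fsym L) of ('I_(farity f) -> term L k).

Inductive formula (L : signature) : nat -> Type :=
| FFalse k : formula L k
| FEq k of term L k & term L k : formula L k
| FRel k (r : rsym L) of ('I_(rarity r) -> term L k) : formula L k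
| FNot k of formula L k : formula L k
| FAnd k of formula L k & formula L k : formula L k
| FEx k of formula L k.+1 : formula L k.

Arguments TVar {L k}.
Arguments TApp {L k}.
Arguments FFalse {L k}.

Record structure (L : signature) := Structure {
  universe :> Type;
  finterp : forall f : fsym L, (farity f).-tuple universe -> universe;
  rinterp : forall r : rsym L, set ((rarity r).-tuple universe) }.

Section Semantics.
Variables (L : signature) (M : structure L).

Fixpoint eval k (e : k.-tuple M) (t : term L k) : M :=
  match t with
  | TVar i => tnth e i
  | TApp f ts => finterp [tuple eval e (ts i) | i < farity f]
  end.

Fixpoint sat k (phi : formula L k) : k.-tuple M -> Prop :=
  match phi with
  | FFalse _ => fun _ => False
  | FEq _ t u => fun e => eval e t = eval e u
  | FRel _ r ts => fun e => rinterp [tuple eval e (ts i) | i < rarity r]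
  | FNot _ p => fun e => ~ sat p e
  | FAnd _ p q => fun e => sat p e /\ sat q e
  | FEx _ p => fun e => exists s : M, sat p (cons_tuple s e)
  end.

(* Definable with parameters. *)
Definition definable n (X : set (n.-tuple M)) : Prop :=
  exists m (phi : formula L (n + m)) (a : m.-tuple M),
    X = [set x : n.-tuple M | sat phi (cat_tuple x a)].

Definition definable_map n (f : n.-tuple M -> n.-tuple M) : Prop :=
  definable [set z : (n + n).-tuple M | exists x : n.-tuple M, z = cat_tuple x (f x)].

End Semantics.

(* [isom_id] says, given the other fields, that no [isom n] is empty; without
   it [simeq] below would not be reflexive. *)
Record isomorphisms L (M : structure L) := Isomorphisms {
  isom : forall n, set (n.-tuple M -> n.-tuple M);
  isom_bij : forall n (f : n.-tuple M -> n.-tuple M), isom f -> bijective f;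
  isom_def : forall n (f : n.-tuple M -> n.-tuple M), isom f -> definable_map f;
  isom_id : forall n, isom (@id (n.-tuple M));
  isom_comp : forall n (f g : n.-tuple M -> n.-tuple M),
    isom f -> isom g -> isom (f \o g);
  isom_inv : forall n (f g : n.-tuple M -> n.-tuple M),
    isom f -> cancel f g -> cancel g f -> isom g }.

Section FirstOrderFacts.
Variables (L : signature) (M : structure L).

Fixpoint ren_term k l (r : 'I_k -> 'I_l) (t : term L k) : term L l :=
  match t with
  | TVar i => TVar (r i)
  | TApp f ts => TApp f (fun i => ren_term r (ts i))
  end.

Definition ren_lift k l (r : 'I_k -> 'I_l) (i : 'I_k.+1) : 'I_l.+1 :=
  if unlift ord0 i is Some j then lift ord0 (r j) else ord0.

Fixpoint ren k (phi : formula L k) : forall l, ('I_k -> 'I_l) -> formula L l :=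
  match phi with
  | FFalse _ => fun l _ => FFalse
  | FEq _ t u => fun l r => FEq (ren_term r t) (ren_term r u)
  | FRel _ s ts => fun l r => FRel (r := s) (fun i => ren_term r (ts i))
  | FNot _ p => fun l r => FNot (ren p r)
  | FAnd _ p q => fun l r => FAnd (ren p r) (ren q r)
  | FEx _ p => fun l r => FEx (ren p (ren_lift r))
  end.

Definition pull k l (r : 'I_k -> 'I_l) (e : l.-tuple M) : k.-tuple M :=
  [tuple tnth e (r i) | i < k].

Lemma eval_ren k l (r : 'I_k -> 'I_l) (e : l.-tuple M) t :
  eval e (ren_term r t) = eval (pull r e) t.
Proof.
elim: t => [i|f ts IH] /=; first by rewrite tnth_mktuple.
by congr finterp; apply: eq_mktuple => i; rewrite IH.
Qed.

Lemma pull_lift k l (r : 'I_k -> 'I_l) (e : l.-tuple M) s :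
  pull (ren_lift r) (cons_tuple s e) = cons_tuple s (pull r e).
Proof.
apply: eq_from_tnth => i; rewrite tnth_mktuple /ren_lift.
case: unliftP => [j ->|->]; last by rewrite !tnth0.
by rewrite !tnthS tnth_mktuple.
Qed.

Lemma sat_ren k (phi : formula L k) l (r : 'I_k -> 'I_l) (e : l.-tuple M) :
  sat (ren phi r) e <-> sat phi (pull r e).
Proof.
elim: phi l r e => [{}k|{}k t u|{}k s ts|{}k p IH|{}k p IHp q IHq|{}k p IH] l r e //=.
- by rewrite !eval_ren.
- suff -> : [tuple eval e (ren_term r (ts i)) | i < rarity s] =
            [tuple eval (pull r e) (ts i) | i < rarity s] by [].
  by apply: eq_mktuple => i; rewrite eval_ren.
- by rewrite IH.
- by rewrite IHp IHq.
- by split=> -[s]; [rewrite IH pull_lift|rewrite -pull_lift -IH] => ?; exists s.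
Qed.

Lemma definable0 n : definable (set0 : set (n.-tuple M)).
Proof. by exists 0%N, FFalse, [tuple]; apply/seteqP; split. Qed.

Lemma definableC n (X : set (n.-tuple M)) : definable X -> definable (~` X).
Proof. by move=> [m [phi [a ->]]]; exists m, (FNot phi), a. Qed.

Lemma definableI n (X Y : set (n.-tuple M)) :
  definable X -> definable Y -> definable (X `&` Y).
Proof.
move=> [m [phi [a ->]]] [p [psi [b ->]]].
pose r1 (i : 'I_(n + m)) : 'I_(n + (m + p)) :=
  match fintype.split i with inl j => lshift _ j | inr j => rshift n (lshift p j) end.
pose r2 (i : 'I_(n + p)) : 'I_(n + (m + p)) :=
  match fintype.split i with inl j => lshift _ j | inr j => rshift n (rshift m j) end.
exists (m + p)%N, (FAnd (ren phi r1) (ren psi r2)), (cat_tuple a b).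
have E1 x : pull r1 (cat_tuple x (cat_tuple a b)) = cat_tuple x a.
  apply: eq_from_tnth => i; rewrite tnth_mktuple /r1.
  have <- := fintype.splitK i; case: (fintype.split i) => j; rewrite unsplitK /=.
    by rewrite !tnth_lshift.
  by rewrite !tnth_rshift tnth_lshift.
have E2 x : pull r2 (cat_tuple x (cat_tuple a b)) = cat_tuple x b.
  apply: eq_from_tnth => i; rewrite tnth_mktuple /r2.
  have <- := fintype.splitK i; case: (fintype.split i) => j; rewrite unsplitK /=.
    by rewrite !tnth_lshift.
  by rewrite !tnth_rshift.
by apply/seteqP; split => x /=; rewrite !sat_ren E1 E2.
Qed.

Lemma definableU n (X Y : set (n.-tuple M)) :
  definable X -> definable Y -> definable (X `|` Y).
Proof.
move=> dX dY; rewrite -[_ `|` _]setCK setCU.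
by apply/definableC/definableI; exact: definableC.
Qed.

Lemma definable_bigcup n (T : finType) (P : T -> set (n.-tuple M)) :
  (forall t, definable (P t)) -> definable (\bigcup_t P t).
Proof.
move=> dP; have : definable [set x | exists2 t, t \in enum T & P t x].
  elim: (enum T) => [|t s IH].
    by have := definable0 n; congr definable; apply/seteqP; split=> x // -[].
  have := definableU (dP t) IH; congr definable; apply/seteqP; split=> x /=.
    move=> [Px|[u us Px]]; first by exists t; rewrite ?mem_head.
    by exists u => //; rewrite inE us orbT.
  by move=> [u]; rewrite inE => /orP[/eqP->|us] Px; [left|right; exists u].
congr definable; apply/seteqP; split=> x [t].
  by move=> _ Px; exists t.
by move=> _ Px; exists t; rewrite ?mem_enum.
Qed.

Lemma definable_pull k n (r : 'I_k -> 'I_n) (X : set (k.-tuple M)) :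
  definable X -> definable [set x : n.-tuple M | X (pull r x)].
Proof.
move=> [m [phi [a ->]]].
pose r1 (i : 'I_(k + m)) : 'I_(n + m) :=
  match fintype.split i with inl j => lshift _ (r j) | inr j => rshift n j end.
exists m, (ren phi r1), a.
have E1 x : pull r1 (cat_tuple x a) = cat_tuple (pull r x) a.
  apply: eq_from_tnth => i; rewrite tnth_mktuple /r1.
  have <- := fintype.splitK i; case: (fintype.split i) => j; rewrite unsplitK /=.
    by rewrite !tnth_lshift tnth_mktuple.
  by rewrite !tnth_rshift.
by apply/seteqP; split => x /=; rewrite !sat_ren E1.
Qed.

Lemma definable_proj n (X : set (n.+1.-tuple M)) :
  definable X -> definable [set x : n.-tuple M | exists s, X (cons_tuple s x)].
Proof.
move=> [m [phi [a ->]]]; exists m, (@FEx L (n + m) phi), a.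
have E s (x : n.-tuple M) : cons_tuple s (cat_tuple x a) =
    cat_tuple (cons_tuple s x) a by exact: val_inj.
by apply/seteqP; split => x /= -[s sphi]; exists s; move: sphi; rewrite E.
Qed.

Lemma definable_projn p n (X : set ((p + n).-tuple M)) : definable X ->
  definable [set x : n.-tuple M | exists y : p.-tuple M, X (cat_tuple y x)].
Proof.
elim: p X => [|p IH] X dX.
  suff -> : [set x : n.-tuple M | exists y : 0.-tuple M, X (cat_tuple y x)] = X by [].
  apply/seteqP; split => x /=.
    by move=> [y]; rewrite tuple0; congr X; apply: val_inj.
  by move=> Xx; exists [tuple]; move: Xx; congr X; apply: val_inj.
suff -> : [set x : n.-tuple M | exists y : p.+1.-tuple M, X (cat_tuple y x)] =
  [set x : n.-tuple M | exists y : p.-tuple M,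
     [set z : (p + n).-tuple M | exists s, X (cons_tuple s z)] (cat_tuple y x)].
  exact/IH/definable_proj.
apply/seteqP; split => x /=.
  move=> [y]; case/tupleP: y => s y Xy; exists y, s.
  by move: Xy; congr X; apply: val_inj.
move=> [y [s Xy]]; exists (cons_tuple s y).
by move: Xy; congr X; apply: val_inj.
Qed.

Lemma definable_image n (f : n.-tuple M -> n.-tuple M) (X : set (n.-tuple M)) :
  definable_map f -> definable X -> definable (f @` X).
Proof.
move=> df dX.
have := definable_projn (definableI df (definable_pull (lshift n) dX)).
have El (x y : n.-tuple M) : pull (lshift n) (cat_tuple x y) = x.
  by apply: eq_from_tnth => i; rewrite tnth_mktuple tnth_lshift.
have Er (x y : n.-tuple M) : pull (@rshift n n) (cat_tuple x y) = y.
  by apply: eq_from_tnth => i; rewrite tnth_mktuple tnth_rshift.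
congr definable; apply/seteqP; split => y /=; last first.
  by move=> [x Xx <-]; exists x; split; [exists x|rewrite El].
move=> [x [[x' e]]]; rewrite El => Xx; exists x => //.
by rewrite -(Er x y) e Er; move/(congr1 (pull (lshift n))): e; rewrite !El => ->.
Qed.

End FirstOrderFacts.

Record defset L (M : structure L) := Defset {
  ddim : nat;
  dset : set (ddim.-tuple M);
  dsetP : definable dset }.

HB.instance Definition _ L (M : structure L) := gen_eqMixin (defset M).
HB.instance Definition _ L (M : structure L) := gen_choiceMixin (defset M).

Section Equidecomposition.
Variables (L : signature) (M : structure L) (I : isomorphisms M).

(* X ~ Y, for definable subsets of the same power of M. *)
Definition simeq n (X Y : set (n.-tuple M)) : Prop :=
  exists (T : finType) (P : T -> set (n.-tuple M))
         (f : T -> n.-tuple M -> n.-tuple M),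
    [/\ forall t, definable (P t) /\ isom I (f t),
        trivIset setT P, \bigcup_t P t = X,
        trivIset setT (fun t => f t @` P t) & \bigcup_t (f t @` P t) = Y].

Definition defset0 : defset M := Defset (definable0 M 0).

(* A sequence [:: X_0; ...; X_r] of definable sets, possibly in different
   powers of M, stands for the disjoint union of the X_i; its points are the
   pairs (i, x) with x in X_i. *)
Definition point := (nat * {n : nat & n.-tuple M})%type.

Local Notation pt i x := (i, existT (fun n : nat => n.-tuple M) _ x).

Definition points (X : seq (defset M)) : set point :=
  [set z | exists2 x : (ddim (nth defset0 X z.1)).-tuple M,
             dset x & z.2 = existT (fun n : nat => n.-tuple M) _ x].

(* One piece of a decomposition: the definable subset [pset] of the component
   of index [psrc] is sent into the component of index [ptgt] by [pmap]. *)
Record piece := Piece {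
  pdim : nat;
  pset : set (pdim.-tuple M);
  pmap : pdim.-tuple M -> pdim.-tuple M;
  psrc : nat;
  ptgt : nat }.

Definition piece_ok (p : piece) : Prop :=
  definable (@pset p) /\ isom I (@pmap p).

Definition dom (p : piece) : set point :=
  [set (pt (psrc p) x) | x in @pset p].

Definition cod (p : piece) : set point :=
  [set (pt (ptgt p) (pmap x)) | x in @pset p].

(* [simeq] for disjoint unions; see [equidecP] for single definable sets. *)
Definition equidec (X Y : seq (defset M)) : Prop :=
  exists (T : finType) (p : T -> piece),
    [/\ forall t, piece_ok (p t),
        trivIset setT (dom \o p), \bigcup_t dom (p t) = points X,
        trivIset setT (cod \o p) & \bigcup_t cod (p t) = points Y].

Let step (p : piece) (z w : point) : Prop :=
  exists2 x, @pset p x &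
    z = (pt (psrc p) x) /\ w = (pt (ptgt p) (pmap x)).

Let existT_inj n (x y : n.-tuple M) :
  existT (fun n => n.-tuple M) n x = existT _ n y -> x = y.
Proof. exact: (Eqdep_dec.inj_pair2_eq_dec _ (@eq_comparable nat)). Qed.

Let domE p z : dom p z <-> exists w, step p z w.
Proof.
split=> [[x Px <-]|[w [x Px [-> _]]]]; last by exists x.
by exists (pt (ptgt p) (pmap x)), x.
Qed.

Let codE p w : cod p w <-> exists z, step p z w.
Proof.
split=> [[x Px <-]|[z [x Px [_ ->]]]]; last by exists x.
by exists (pt (psrc p) x), x.
Qed.

Let step_fun p z w w' : step p z w -> step p z w' -> w = w'.
Proof.
by move=> [x _ [-> ->]] [y _ [[] /existT_inj -> ->]].
Qed.

Let step_inj p z z' w : piece_ok p -> step p z w -> step p z' w -> z = z'.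
Proof.
move=> [_ /isom_bij /bij_inj fI] [x _ [-> ->]] [y _ [-> []]].
by move=> /existT_inj /fI ->.
Qed.

Let step_comp p q : piece_ok p -> piece_ok q -> exists r, piece_ok r /\
  forall z w, step r z w <-> exists2 y, step p z y & step q y w.
Proof.
move=> okp okq.
have [[epq eb]|ne] := pselect (pdim p = pdim q /\ ptgt p = psrc q); last first.
  exists (Piece (set0 : set (0.-tuple M)) id 0 0); split.
    by split; [exact: definable0|exact: isom_id].
  move=> z w; split=> [[]//|[y [x _ [_ ->]] [x' _ [[e1 e2 _] _]]]].
  by case: ne.
case: p q okp okq epq eb => n P f a b [m Q g c d] /= okp okq e eb.
case: m / e Q g okq => Q g okq; rewrite -{}eb in okq *.
case: okp okq => /= dP If [/= dQ Ig].
have [f' fK f'K] := isom_bij If.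
exists (Piece (P `&` f' @` Q) (g \o f) a d); split.
  split; last exact: isom_comp.
  apply: definableI => //; apply: definable_image => //.
  exact/(isom_def (i := I))/(isom_inv If).
move=> z w; split.
  move=> [/= x [Px [y Qy xy]] [-> ->]].
  have yx : y = f x by rewrite -xy f'K.
  by exists (pt b (f x)); [exists x|exists (f x) => //; rewrite -yx].
move=> [y [/= x Px [-> ->]] [/= x' Qx' [[/existT_inj e] ->]]].
exists x => /=; last by rewrite -e.
by split => //; exists x' => //; rewrite -e fK.
Qed.

Let step_inv p : piece_ok p -> exists r, piece_ok r /\
  forall z w, step r z w <-> step p w z.
Proof.
case: p => n P f a b [/= dP If]; have [g fK gK] := isom_bij If.
exists (Piece (f @` P) g b a); split.
  split=> /=; last exact: isom_inv If _ _.
  by apply: definable_image => //; exact: isom_def If.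
move=> z w; split.
  by move=> [/= _ [x Px <-] [-> ->]]; exists x => //=; rewrite fK.
move=> [/= x Px [-> ->]]; exists (f x) => /=; first by exists x.
by rewrite fK.
Qed.

(* An equidecomposition seen as a bijection between sets of points. *)
Let equidecE X Y : equidec X Y <-> exists (T : finType) (p : T -> piece),
  [/\ forall t, piece_ok (p t),
      forall t z w, step (p t) z w -> points X z /\ points Y w,
      forall z, points X z -> exists t, exists w, step (p t) z w,
      forall w, points Y w -> exists t, exists z, step (p t) z w &
      forall t u z w z' w', step (p t) z w -> step (p u) z' w' ->
         z = z' \/ w = w' -> t = u].
Proof.
split=> -[T [p]].
  move=> [ok tX dX tY dY]; exists T, p; split=> //.
  - move=> t z w s; rewrite -dX -dY; split; exists t => //.
      by apply/domE; exists w.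
    by apply/codE; exists z.
  - by move=> z; rewrite -dX => -[t _ /domE]; exists t.
  - by move=> w; rewrite -dY => -[t _ /codE]; exists t.
  - move=> t u z w z' w' s s' [e|e]; [apply: tX => //; exists z|apply: tY => //; exists w].
      by split; apply/domE; [exists w|exists w'; rewrite e].
    by split; apply/codE; [exists z|exists z'; rewrite e].
move=> [ok sXY sX sY sI]; exists T, p; split=> //.
- move=> t u _ _ [z [/domE[w s] /domE[w' s']]].
  by apply: sI s s' _; left.
- apply/seteqP; split=> [z [t _ /domE[w /sXY[]]]//|z /sX[t zw]].
  by exists t => //; apply/domE.
- move=> t u _ _ [w [/codE[z s] /codE[z' s']]].
  by apply: sI s s' _; right.
- apply/seteqP; split=> [z [t _ /codE[w /sXY[]]]//|z /sY[t zw]].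
  by exists t => //; apply/codE.
Qed.

Lemma equidec_sym X Y : equidec X Y -> equidec Y X.
Proof.
move=> /equidecE[T [p [ok sXY sX sY sI]]]; apply/equidecE.
have [q qP] := choice (fun t => step_inv (ok t)).
exists T, q; split.
- by move=> t; case: (qP t).
- by move=> t z w /(qP t).2 /sXY[].
- by move=> z /sY[t [w s]]; exists t, w; apply/(qP t).2.
- by move=> z /sX[t [w s]]; exists t, w; apply/(qP t).2.
- move=> t u z w z' w' /(qP t).2 s /(qP u).2 s' e; apply: sI s s' _.
  by case: e; auto.
Qed.

Lemma equidec_trans X Y Z : equidec X Y -> equidec Y Z -> equidec X Z.
Proof.
move=> /equidecE[T [p [okp pXY pX pY pI]]] /equidecE[U [q [okq qYZ qY qZ qI]]].
apply/equidecE.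
have [r rP] := choice (fun tu : T * U => step_comp (okp tu.1) (okq tu.2)).
exists (T * U)%type, r; split.
- by move=> t; case: (rP t).
- by move=> t z w /(rP t).2[y /pXY[? _] /qYZ[_ ?]].
- move=> z /pX[t [y s]]; have [_ /qY[u [w s']]] := pXY _ _ _ s.
  by exists (t, u), w; apply/(rP (t, u)).2; exists y.
- move=> w /qZ[u [y s]]; have [/pY[t [z s']] _] := qYZ _ _ _ s.
  by exists (t, u), z; apply/(rP (t, u)).2; exists y.
- move=> [t u] [t' u'] z w z' w' /(rP (t, u)).2[/= y s1 s2].
  move=> /(rP (t', u')).2[/= y' s1' s2'] [e|e]; subst.
    have et : t = t' by apply: pI s1 s1' _; left.
    subst; congr pair; apply: qI s2 s2' _; left; exact: step_fun s1 s1'.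
  have et : u = u' by apply: qI s2 s2' _; right.
  subst; congr pair; apply: pI s1 s1' _; right; exact: step_inj s2 s2'.
Qed.

Let pointsP X i n (x : n.-tuple M) :
  points X (pt i x) -> (i < size X)%N.
Proof.
move=> [/= y]; case: ltnP => // le; move: y; rewrite nth_default //.
Qed.

Lemma perm_equidec X Y : perm_eq X Y -> equidec X Y.
Proof.
move=> /(perm_iotaP defset0)[s ps eX].
have uX : uniq s by rewrite (perm_uniq ps) iota_uniq.
have szX : size X = size s by rewrite eX size_map.
have szY : size s = size Y by rewrite (perm_size ps) size_iota.
pose p (i : 'I_(size X)) :=
  Piece (dset (d := nth defset0 X i)) id i (nth 0 s i).
have stepP i z w : step (p i) z w <-> exists2 x, dset (d := nth defset0 X i) x &
    z = pt (val i) x /\ w = pt (nth 0 s i) x by [].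
have nthX i : (i < size X)%N -> nth defset0 X i = nth defset0 Y (nth 0 s i).
  by rewrite szX => lt; rewrite eX (nth_map 0).
apply/equidecE; exists 'I_(size X), p; split.
- by move=> t; split; [exact: dsetP|exact: isom_id].
- move=> t z w /stepP[x dx [-> ->]]; split; first by exists x.
  by rewrite /points /= -nthX //; exists x.
- move=> [i [n x]] px; have lt := pointsP px; exists (Ordinal lt).
  case: px => /= y dy e; exists (pt (nth 0 s i) y).
  by apply/stepP; exists y => //; rewrite e.
- move=> [j [n x]] py; have lt := pointsP py.
  have js : j \in s by rewrite (perm_mem ps) mem_iota.
  have lti : (index j s < size X)%N by rewrite szX index_mem.
  exists (Ordinal lti); case: py => /= y; move: y.
  have {1 2 3}-> : nth defset0 Y j = nth defset0 X (index j s).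
    by rewrite nthX // nth_index.
  move=> y dy ->; exists (pt (index j s) y).
  by apply/stepP; exists y => //=; rewrite nth_index.
- move=> t u z w z' w' /stepP[x _ [-> ->]] /stepP[y _ [-> ->]] [[e _ _]|[e _ _]].
    exact: ord_inj.
  by apply/ord_inj/eqP; rewrite -(nth_uniq 0 _ _ uX) -?szX //; apply/eqP.
Qed.

Lemma equidec_refl X : equidec X X.
Proof. exact: perm_equidec. Qed.

Let shift i (z : point) : point := ((i + z.1)%N, z.2).

Let points_cat X Y z : points (X ++ Y) z <->
  points X z \/ exists2 y, points Y y & z = shift (size X) y.
Proof.
case: z => i [n x]; rewrite {1}/points /= nth_cat; case: ltnP => lt.
  split; first by left.
  case=> // -[[j u] _ [e]]; move: lt; rewrite e /=.
  by rewrite ltnNge leq_addr.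
split.
  move=> py; right; exists (pt (i - size X)%N x) => //.
  by rewrite /shift /= subnKC.
case=> [/pointsP|[[j u] py [-> /= ->]]]; first by rewrite ltnNge lt.
by rewrite addKn.
Qed.

Let step_shift p a b : piece_ok p -> exists r, piece_ok r /\
  forall z w, step r z w <->
    exists z' w', [/\ step p z' w', z = shift a z' & w = shift b w'].
Proof.
case: p => n P f i j ok; exists (Piece P f (a + i) (b + j)); split=> // z w.
split=> [[x /= Px [-> ->]]|[z' [w' [[x /= Px [-> ->]] -> ->]]]]; last by exists x.
by exists (pt i x), (pt j (f x)); split=> //; exists x.
Qed.

Let shift_inj a : injective (shift a).
Proof. by move=> [i x] [j y] [/addnI -> ->]. Qed.

Let points_shift X z y : points X z -> z <> shift (size X) y.
Proof.
case: z => i [n x] /pointsP lt [e _]; move: lt.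
by rewrite e ltnNge leq_addr.
Qed.

Lemma equidec_cat X X' Y Y' :
  equidec X X' -> equidec Y Y' -> equidec (X ++ Y) (X' ++ Y').
Proof.
move=> /equidecE[T [p [okp pE pX pY pI]]] /equidecE[U [q [okq qE qX qY qI]]].
apply/equidecE.
have [r rP] := choice (fun u => step_shift (size X) (size X') (okq u)).
pose s (v : T + U) := match v with inl t => p t | inr u => r u end.
exists (T + U)%type, s; split.
- by case=> [t|u] /=; [exact: okp|case: (rP u)].
- case=> [t|u] z w /= => [/pE[zX wX]|/(rP u).2[z' [w' [/qE[zY wY] -> ->]]]].
    by split; apply/points_cat; left.
  by split; apply/points_cat; right; [exists z'|exists w'].
- move=> z /points_cat[/pX[t [w st]]|[y /qX[u [w st]] ->]].
    by exists (inl t), w.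
  by exists (inr u), (shift (size X') w); apply/(rP u).2; exists y, w.
- move=> z /points_cat[/pY[t [w st]]|[y /qY[u [w st]] ->]].
    by exists (inl t), w.
  by exists (inr u), (shift (size X) w); apply/(rP u).2; exists w, y.
- case=> [t|u] [t'|u'] z w z' w' /=.
  + by move=> s1 s2 e; congr inl; apply: pI s1 s2 e.
  + move=> /pE[zX wX] /(rP u').2[y [y' [_ -> ->]]] [/esym e|/esym e].
      by case: (points_shift (y := y) zX).
    by case: (points_shift (y := y') wX).
  + move=> /(rP u).2[y [y' [_ -> ->]]] /pE[zX wX] [e|e].
      by case: (points_shift (y := y) zX).
    by case: (points_shift (y := y') wX).
  + move=> /(rP u).2[y [y' [s1 -> ->]]] /(rP u').2[y1 [y1' [s2 -> ->]]] e.
    congr inr; apply: qI s1 s2 _.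
    by case: e => /shift_inj; auto.
Qed.

Let points1 n (X : set (n.-tuple M)) (dX : definable X) z :
  points [:: Defset dX] z <-> exists2 x, X x & z = pt 0 x.
Proof.
case: z => -[|i] [m y]; rewrite /points /=.
  by split=> -[x Xx e]; exists x => //; [rewrite e|case: e].
by case: i => [|i]; split=> -[].
Qed.

Let step_restr n p : piece_ok p ->
  exists Pf : set (n.-tuple M) * (n.-tuple M -> n.-tuple M),
    [/\ definable Pf.1, isom I Pf.2 & forall x y,
      Pf.1 x /\ Pf.2 x = y <-> step p (pt 0 x) (pt 0 y)].
Proof.
case: p => m P f a b [/= dP If].
have [[e [ea eb]]|ne] := pselect (m = n /\ a = 0%N /\ b = 0%N); last first.
  exists (set0, id); split; [exact: definable0|exact: isom_id|].
  move=> x y; split=> [[]//|[/= z _ [[e1 e2 _] [e3 _]]]].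
  by case: ne.
case: n / e; subst; exists (P, f); split=> // x y; split=> /= [[Px <-]|].
  by exists x.
by move=> [/= z Pz [[/existT_inj ->] [/existT_inj ->]]].
Qed.

(* On single definable sets [equidec] is the relation [simeq]. *)
Lemma equidecP n (X Y : set (n.-tuple M)) (dX : definable X) (dY : definable Y) :
  equidec [:: Defset dX] [:: Defset dY] <-> simeq X Y.
Proof.
split.
  move=> /equidecE[T [p [okp pXY pX pY pI]]].
  have [Pf PfP] := choice (fun t => step_restr n (okp t)).
  have S t x : (Pf t).1 x -> step (p t) (pt 0 x) (pt 0 ((Pf t).2 x)).
    by move=> Px; case: (PfP t) => _ _ h; apply/h.
  exists T, (fun t => (Pf t).1), (fun t => (Pf t).2); split.
  - by move=> t; case: (PfP t).
  - by move=> t u _ _ [x [/S s1 /S s2]]; apply: pI s1 s2 _; left.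
  - apply/seteqP; split=> x.
      move=> [t _ /S /pXY[/points1[x' Xx' []]]].
      by move=> /existT_inj ->.
    move=> Xx; have [|t [w s]] := pX (pt 0 x); first by apply/points1; exists x.
    have [_ /points1[y _ e]] := pXY _ _ _ s; exists t => //.
    by case: (PfP t) => _ _ h; rewrite e in s; case/h: s.
  - move=> t u _ _ [y [[x /S s1 <-] [x' /S s2 e]]].
    by apply: pI s1 s2 _; right; rewrite e.
  - apply/seteqP; split=> y.
      move=> [t _ [x /S /pXY[_ /points1[x' Xx' []]]]].
      by move=> /existT_inj -> <-.
    move=> Yy; have [|t [w s]] := pY (pt 0 y); first by apply/points1; exists y.
    have [/points1[x _ e] _] := pXY _ _ _ s; exists t => //.
    by case: (PfP t) => _ _ h; rewrite e in s; case/h: s => Px <-; exists x.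
move=> [T [P [f [ok tP uX tf uY]]]]; apply/equidecE.
exists T, (fun t => Piece (P t) (f t) 0 0); split=> //.
- move=> t z w [/= x Px [-> ->]]; split; apply/points1.
    by exists x => //; rewrite -uX; exists t.
  by exists (f t x) => //; rewrite -uY; exists t => //; exists x.
- move=> z /points1[x]; rewrite -uX => -[t _ Px] ->.
  by exists t, (pt 0 (f t x)), x.
- move=> z /points1[x]; rewrite -uY => -[t _ [y Py <-]] ->.
  by exists t, (pt 0 y), y.
- move=> t u z w z' w' [/= x Px [-> ->]] [/= y Py [-> ->]].
  move=> [[/existT_inj e]|[/existT_inj e]].
    by apply: tP => //; exists x; split => //; rewrite e.
  by apply: tf => //; exists (f t x); split; [exists x|rewrite e; exists y].
Qed.

Lemma equidec_set0 n : equidec [:: Defset (definable0 M n)] [::].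
Proof.
apply/equidecE.
exists void, (fun t : void => match t with end).
split=> [[]|[]|z /points1[]//|[[|i] [m x]] []//|[]].
Qed.

Lemma equidec_setU n (X Y : set (n.-tuple M)) (dX : definable X)
    (dY : definable Y) (dXY : definable (X `|` Y)) :
  X `&` Y = set0 -> equidec [:: Defset dX; Defset dY] [:: Defset dXY].
Proof.
move=> XY0; have P2 z : points [:: Defset dX; Defset dY] z <->
    (exists2 x, X x & z = pt 0 x) \/ (exists2 y, Y y & z = pt 1 y).
  rewrite -cat1s points_cat points1.
  split=> [[|[y /points1[x Yx ->] ->]]|[|[x Yx ->]]]; [by left| |by left|].
    by right; exists x.
  by right; exists (pt 0 x) => //; apply/points1; exists x.
apply/equidecE; exists bool,
  (fun b => if b then Piece X id 0 0 else Piece Y id 1 0); split.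
- by case; split=> //; exact: isom_id.
- case=> z w [/= x Xx [-> ->]]; split; rewrite ?P2 ?points1.
  + by left; exists x.
  + by exists x => //; left.
  + by right; exists x.
  + by exists x => //; right.
- move=> z /P2[[x Xx ->]|[x Yx ->]].
    by exists true, (pt 0 x), x.
  by exists false, (pt 0 x), x.
- move=> z /points1[x [Xx|Yx] ->].
    by exists true, (pt 0 x), x.
  by exists false, (pt 1 x), x.
- case=> [] [] // z w z' w' [/= x Xx [-> ->]] [/= y Yy [-> ->]] [[]//|[]].
    move=> /existT_inj e; subst; suff : (X `&` Y) y by rewrite XY0.
    by split.
  move=> /existT_inj e; subst; suff : (X `&` Y) y by rewrite XY0.
  by split.
Qed.

Let definable_cod n p : piece_ok p ->
  definable [set x : n.-tuple M | cod p (pt 0 x)].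
Proof.
case: p => m P f a b [/= dP If].
have [[e eb]|ne] := pselect (m = n /\ b = 0%N); last first.
  have := definable0 M n; congr definable; apply/seteqP; split=> x //.
  by move=> [/= y _ [e1 e2 _]]; case: ne.
case: n / e; subst; have := definable_image (isom_def If) dP.
congr definable; apply/seteqP; split=> x; first by move=> [y Py <-]; exists y.
by move=> [/= y Py [/existT_inj <-]]; exists y.
Qed.

(* The summands of the class of a definable set are classes of definable sets. *)
Lemma equidec_split A B n (X : set (n.-tuple M)) (dX : definable X) :
  equidec (A ++ B) [:: Defset dX] ->
  exists (Y Z : set (n.-tuple M)) (dY : definable Y) (dZ : definable Z),
    [/\ Y `|` Z = X, Y `&` Z = set0,
        equidec A [:: Defset dY] & equidec B [:: Defset dZ]].
Proof.
move=> /equidecE[T [p [okp pE pA pX pI]]].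
pose l t := (psrc (p t) < size A)%N.
pose nil : piece := Piece (set0 : set (0.-tuple M)) id 0 0.
have ok0 : piece_ok nil by split; [exact: definable0|exact: isom_id].
pose q t := if l t then p t else nil.
pose down (r : piece) := Piece (@pset r) (@pmap r) (psrc r - size A) (ptgt r).
pose r t := if l t then nil else down (p t).
have okq t : piece_ok (q t) by rewrite /q; case: ifP.
have okr t : piece_ok (r t) by rewrite /r; case: ifP => // _; exact: okp.
have nilF z w : ~ step nil z w by case.
have qE t z w : step (q t) z w <-> step (p t) z w /\ points A z.
  rewrite /q; case: ifP => lt; split=> //.
  - move=> s; split=> //; case: (pE _ _ _ s) => /points_cat[//|[y _ e]].
    case: s => x _ [ez _]; move: e lt; rewrite ez /l => -[-> _].
    by rewrite ltnNge leq_addr.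
  - by case.
  - by move=> s; case: (nilF _ _ s).
  - by move=> [[x _ [-> _]] /pointsP]; rewrite -/(l t) lt.
have rE t z w : step (r t) z w <-> step (p t) (shift (size A) z) w /\ points B z.
  rewrite /r; case: ifP => lt.
    split; first by move=> s; case: (nilF _ _ s).
    move=> [[x _ [ez _]] _]; move: ez lt => [e _]; rewrite /l -e.
    by rewrite ltnNge leq_addr.
  have le : (size A <= psrc (p t))%N by rewrite leqNgt -/(l t) lt.
  split.
    move=> [/= x Px [-> ->]].
    have s : step (p t) (shift (size A) (pt (psrc (p t) - size A)%N x))
        (pt (ptgt (p t)) (pmap x)).
      by exists x => //; rewrite /shift /= subnKC.
    split=> //; have [/points_cat[/points_shift/(_ erefl)//|]] := pE _ _ _ s.
    by move=> [y By /shift_inj ->].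
  move=> [[/= x Px [e ->]] _]; exists x => //=; split=> //.
  by case: z e => j u [/= <- ->]; rewrite addKn.
pose Y := \bigcup_t [set x : n.-tuple M | cod (q t) (pt 0 x)].
pose Z := \bigcup_t [set x : n.-tuple M | cod (r t) (pt 0 x)].
have dY : definable Y by apply: definable_bigcup => t; exact: definable_cod.
have dZ : definable Z by apply: definable_bigcup => t; exact: definable_cod.
exists Y, Z, dY, dZ; split.
- apply/seteqP; split=> x.
    move=> [[t _ /codE[z /qE[/pE[_ /points1[y Xy e]] _]]]|
            [t _ /codE[z /rE[/pE[_ /points1[y Xy e]] _]]]];
    by case: e => /existT_inj ->.
  move=> Xx; have [|t [z s]] := pX (pt 0 x); first by apply/points1; exists x.
  have [/points_cat[Az|[y By e]] _] := pE _ _ _ s.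
    by left; exists t => //; apply/codE; exists z; apply/qE.
  by right; exists t => //; apply/codE; exists y; apply/rE; rewrite -e.
- apply/seteqP; split=> x // -[[t _ /codE[z /qE[s Az]]] [u _ /codE[y /rE[s' By]]]].
  have e := pI _ _ _ _ _ _ s s' (or_intror erefl); subst.
  by have := step_inj (okp u) s s'; exact: points_shift.
- apply/equidecE; exists T, q; split=> //.
  + move=> t z w s; split; first by case/qE: s.
    case/qE: (s) => /pE[_ /points1[x _ e]] _; apply/points1; exists x => //.
    by exists t => //; apply/codE; exists z; rewrite -e.
  + move=> z Az; have [|t [w s]] := pA z; first by apply/points_cat; left.
    by exists t, w; apply/qE.
  + by move=> w /points1[x [t _ /codE[z s]] ->]; exists t, z.
  + by move=> t u z w z' w' /qE[s _] /qE[s' _]; exact: pI s s'.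
- apply/equidecE; exists T, r; split=> //.
  + move=> t z w s; split; first by case/rE: s.
    case/rE: (s) => /pE[_ /points1[x _ e]] _; apply/points1; exists x => //.
    by exists t => //; apply/codE; exists z; rewrite -e.
  + move=> z Bz; have [|t [w s]] := pA (shift (size A) z).
      by apply/points_cat; right; exists z.
    by exists t, w; apply/rE.
  + by move=> w /points1[x [t _ /codE[z s]] ->]; exists t, z.
  + move=> t u z w z' w' /rE[s _] /rE[s' _] e; apply: pI s s' _.
    by case: e => ->; [left|right].
Qed.

Definition equidecb : rel (seq (defset M)) := fun X Y => `[< equidec X Y >].

Lemma equidecb_refl : reflexive equidecb.
Proof. by move=> X; apply/asboolP/equidec_refl. Qed.

Lemma equidecb_sym : symmetric equidecb.
Proof.
by move=> X Y; apply/asboolP/asboolP; apply: equidec_sym.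
Qed.

Lemma equidecb_trans : transitive equidecb.
Proof.
by move=> Y X Z /asboolP XY /asboolP YZ; apply/asboolP/(equidec_trans XY).
Qed.

Canonical equidec_equiv :=
  EquivRel equidecb equidecb_refl equidecb_sym equidecb_trans.

End Equidecomposition.

Section Ksemi.
Variables (L : signature) (M : structure L) (I : isomorphisms M).

Local Open Scope quotient_scope.
Local Open Scope ring_scope.

(* Isomorphisms do not change the ambient power M^n, so two definable sets need
   not have disjoint copies in a common power; the sum is therefore induced by
   the formal disjoint union [++].  By [K_class_simeq], [K_class_setU] and
   [K_class_set0], definable sets have the same class iff they are related by
   [simeq], and + and 0 come from disjoint union and the empty set; by
   [K_class_split], splitting the class of a definable set amounts to
   partitioning that set into two definable sets. *)
Definition K_semi := {eq_quot equidec_equiv I}.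

HB.instance Definition _ := Choice.on K_semi.
HB.instance Definition _ := EqQuotient.on K_semi.

Definition K_class (X : seq (defset M)) : K_semi := \pi_K_semi X.

Lemma K_classP X Y : K_class X = K_class Y <-> equidec I X Y.
Proof. by split=> [/eqP|e]; [rewrite eqmodE => /asboolP|apply/eqP; rewrite eqmodE; apply/asboolP]. Qed.

Lemma K_class_surj (a : K_semi) : exists X, a = K_class X.
Proof. by exists (repr a); rewrite /K_class reprK. Qed.

Definition K_add (a b : K_semi) : K_semi := K_class (repr a ++ repr b).

Lemma K_class_cat X Y : K_add (K_class X) (K_class Y) = K_class (X ++ Y).
Proof.
by apply/K_classP/equidec_cat; apply/K_classP; rewrite {1}/K_class reprK.
Qed.

Lemma K_addA : associative K_add.
Proof.
move=> a b c; have [X ->] := K_class_surj a; have [Y ->] := K_class_surj b.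
by have [Z ->] := K_class_surj c; rewrite !K_class_cat catA.
Qed.

Lemma K_addC : commutative K_add.
Proof.
move=> a b; have [X ->] := K_class_surj a; have [Y ->] := K_class_surj b.
by rewrite !K_class_cat; apply/K_classP/perm_equidec; rewrite perm_catC.
Qed.

Lemma K_add0 : left_id (K_class [::]) K_add.
Proof. by move=> a; have [X ->] := K_class_surj a; rewrite K_class_cat. Qed.

HB.instance Definition _ := GRing.isNmodule.Build K_semi K_addA K_addC K_add0.

Lemma K_classD X Y : K_class X + K_class Y = K_class (X ++ Y).
Proof. exact: K_class_cat. Qed.

Lemma K_class_set0 n : K_class [:: Defset (definable0 M n)] = 0.
Proof. exact/K_classP/equidec_set0. Qed.

Lemma K_class_simeq n (X Y : set (n.-tuple M)) (dX : definable X)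
    (dY : definable Y) :
  K_class [:: Defset dX] = K_class [:: Defset dY] <-> simeq I X Y.
Proof. by rewrite K_classP; exact: equidecP. Qed.

Lemma K_class_setU n (X Y : set (n.-tuple M)) (dX : definable X)
    (dY : definable Y) (dXY : definable (X `|` Y)) : X `&` Y = set0 ->
  K_class [:: Defset dXY] = K_class [:: Defset dX] + K_class [:: Defset dY].
Proof. by move=> XY0; rewrite K_classD; apply/esym/K_classP/equidec_setU. Qed.

Lemma K_class_split n (X : set (n.-tuple M)) (dX : definable X) (a b : K_semi) :
  a + b = K_class [:: Defset dX] ->
  exists (Y Z : set (n.-tuple M)) (dY : definable Y) (dZ : definable Z),
    [/\ Y `|` Z = X, Y `&` Z = set0,
        a = K_class [:: Defset dY] & b = K_class [:: Defset dZ]].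
Proof.
have [A ->] := K_class_surj a; have [B ->] := K_class_surj b.
rewrite K_classD => /K_classP /equidec_split[Y [Z [dY [dZ [U D eA eB]]]]].
by exists Y, Z, dY, dZ; split=> //; apply/K_classP.
Qed.

End Ksemi.

Section Preorders.
Variable K : nmodType.
Implicit Types a b : K.
Local Open Scope ring_scope.

Definition K_le a b : Prop := exists c, a + c = b.

(* a <=_m b *)
Definition K_le_at (m : rat) a b : Prop :=
  exists p q : nat, [/\ (0 < p)%N, (0 < q)%N,
    m <= p%:R / q%:R & K_le (a *+ p) (b *+ q)].

(* a <=_0 b *)
Definition K_le0 a b : Prop :=
  forall m : rat, 0 < m ->
    exists a' a'', [/\ a' + a'' = a, K_le_at m a' a & K_le a'' b].

End Preorders.

(* Main.v *)
(** The monoid [K_semi I] has the refinement property, since the pieces of an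
    equidecomposition of [A ++ B] with [C ++ D] can be sorted by source and
    target; the rest holds in any refinement monoid.  There, [a + c = b + c]
    can be cancelled up to a remainder that fits [n] times into [c], for every
    [n].  Write [alpha = d + u] and [beta = d + v]; cancelling [k d] gives
    [k u <= k v + e] with [e] negligible.  Since [u <= k v + e], a greedy
    matching moves a part [d1] of [u] and [v] into [d] and leaves [u'] with
    [u' <= e + (k - 1) d1], hence [k u' <= (k - 1) u + e].  Iterating makes the
    unmatched part of [alpha] arbitrarily small. *)

Require Import Defs.
From mathcomp Require Import all_boot all_order all_algebra.
From mathcomp Require Import boolp classical_sets zify.

Set Implicit Arguments.
Unset Strict Implicit.
Unset Printing Implicit Defensive.
Import Order.TTheory GRing.Theory Num.Theory.

Local Open Scope ring_scope.

(** * Approximate cancellation in refinement monoids *)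

Definition refinement (K : nmodType) : Prop :=
  forall a b c d : K, a + b = c + d ->
  exists x y z t : K, [/\ a = x + y, b = z + t, c = x + z & d = y + t].

Section RefinementMonoids.
Variable K : nmodType.
Implicit Types a b c d e u v x y z : K.

Lemma K_le_refl a : K_le a a.
Proof. by exists 0; rewrite addr0. Qed.

Lemma K_le_trans b a c : K_le a b -> K_le b c -> K_le a c.
Proof. by move=> [x <-] [y <-]; exists (x + y); rewrite addrA. Qed.

Lemma K_leD a b c d : K_le a b -> K_le c d -> K_le (a + c) (b + d).
Proof. by move=> [x <-] [y <-]; exists (x + y); rewrite addrACA. Qed.

Lemma K_le_mulrn n a b : K_le a b -> K_le (a *+ n) (b *+ n).
Proof. by move=> [x <-]; exists (x *+ n); rewrite mulrnDl. Qed.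

Lemma K_le_addr a b : K_le a (a + b).
Proof. by exists b. Qed.

Lemma K_le_addl a b : K_le b (a + b).
Proof. by exists a; rewrite addrC. Qed.

Hypothesis K_refine : refinement K.

Lemma K_le_decompose a b c : K_le a (b + c) ->
  exists a1 a2, [/\ a = a1 + a2, K_le a1 b & K_le a2 c].
Proof.
move=> [w] /K_refine[x [y [z [t [-> _ -> ->]]]]].
by exists x, y; split; [|exists z|exists t].
Qed.

(** Refining [a' + c' = b' + c'] moves a common part [x] into [d] and leaves [y], [z] with
    [c' = y + t = z + t]. So [y + t = z + t] is again of the same form, and one more copy of the new
    remainder [y] has been carved out of [c]. *)
Lemma almost_cancel a b c n : a + c = b + c ->
  exists d a' b', [/\ a = d + a', b = d + b' & K_le (a' *+ n) c].
Proof.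
move=> ac.
suff [d [a' [b' [c' [-> -> _ le]]]]] : exists d a' b' c',
    [/\ a = d + a', b = d + b', a' + c' = b' + c' & K_le (a' *+ n + c') c].
  by exists d, a', b'; split=> //; apply: K_le_trans le; exact: K_le_addr.
elim: n => [|n [d [a' [b' [c' [-> -> e le]]]]]].
  by exists 0, a, b, c; rewrite !add0r; split=> //; exact: K_le_refl.
have [x [y [z [t [ea ec eb ec']]]]] := K_refine e.
exists (d + x), y, z, t; split; rewrite -?addrA -?ea -?eb -?ec -?ec' //.
apply: K_le_trans le; rewrite mulrSr -addrA -ec' ea mulrnDl.
by apply: K_leD (K_le_refl _); exact: K_le_addl.
Qed.

Lemma K_le_almost_cancel a b c n : K_le (c + a) (c + b) ->
  exists2 e, K_le a (e + b) & K_le (e *+ n) c.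
Proof.
move=> [w]; rewrite -addrA addrC (addrC c) => /(almost_cancel n).
move=> [d [e [b' [aw -> le]]]]; exists e => //.
apply: (@K_le_trans (e + d)); first by exists w; rewrite aw addrC.
by apply: K_leD; [exact: K_le_refl|exact: K_le_addr].
Qed.

(* Greedy matching: [u] splits into a part below [e] and [k.+1] parts below
   [v]; what is left of the [i]-th part is blocked in [v] by what was matched
   before, and the first of these parts is not blocked. *)
Lemma greedy_matching k u v e : K_le u (e + v *+ k.+1) ->
  exists d u' v', [/\ u = d + u', v = d + v' & K_le u' (e + d *+ k)].
Proof.
elim: k u v e => [|k IH] u v e; [rewrite mulr1n|rewrite mulrSr addrA].
  move=> /K_le_decompose[u' [d [-> le [v' <-]]]].
  by exists d, u', v'; rewrite addr0 addrC.
move=> /K_le_decompose[u1 [f [-> le [v1 vE]]]].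
move: le; rewrite -{1}vE mulrnDl addrA => /IH[d [u' [v' [-> v1E le]]]].
exists (f + d), u', v'; split; first by rewrite addrC addrA.
  by rewrite -addrA -v1E vE.
apply: K_le_trans le _; rewrite mulrnDl -addrA.
apply: K_leD (K_le_refl _) _; apply: K_leD (K_le_refl _) _.
by rewrite mulrS; exact: K_le_addl.
Qed.

(** The unmatched share [q / p] of [a] shrinks in each round by a factor of at most
    [1 - 1 / (2 (k + 1))]. This geometric decay is recorded only through the weaker bound
    [2 (k + 1) / (2 (k + 1) + n)], which is enough because it tends to 0. *)
Lemma iterated_matching k a b n : K_le (a *+ k.+1) (b *+ k.+1) ->
  exists d u v p q, [/\ a = d + u, b = d + v, K_le (u *+ p) (a *+ q),
    (0 < p)%N && (0 < q)%N & (q * (2 * k.+1 + n) <= p * (2 * k.+1))%N].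
Proof.
move=> ab; elim: n => [|n [d [u [v [p [q [aE bE up /andP[p0 q0] pq]]]]]]].
  exists 0, a, b, 1%N, 1%N; rewrite !add0r; split=> //; first exact: K_le_refl.
  by rewrite addn0.
(* The new share is [1 / N + (k / (k + 1)) (q / p)]. As [0 < q], the error [1 / N] is at most half
   of the gain [q / ((k + 1) p)]. *)
pose N := (2 * k.+1 * p)%N.
have [e ue eN] : exists2 e, K_le (u *+ k.+1) (e + v *+ k.+1) &
    K_le (e *+ N) (d *+ k.+1).
  by apply: K_le_almost_cancel; rewrite -!mulrnDl -aE -bE.
have [|d1 [u' [v' [uE vE le]]]] := @greedy_matching k u v e.
  by apply: K_le_trans ue; rewrite mulrS; exact: K_le_addr.
exists (d + d1), u', v', (k.+1 * (p * N))%N, (k.+1 * p + q * (k * N))%N.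
split; rewrite -?addrA -?uE -?vE //; last 2 first.
- by rewrite /N !muln_gt0 p0 addn_gt0 muln_gt0 p0.
- by rewrite /N; nia.
have {}le : K_le (u' *+ k.+1) (e + u *+ k).
  rewrite mulrS uE mulrnDl addrA.
  by apply: K_leD le (K_le_refl _).
rewrite mulrnA; apply: K_le_trans (K_le_mulrn _ le) _.
rewrite mulrnDl mulrnDr -mulrnA; apply: K_leD.
  rewrite mulnC mulrnA [X in K_le _ X]mulrnA; apply: K_le_mulrn.
  by apply: K_le_trans eN _; apply: K_le_mulrn; rewrite aE; exact: K_le_addr.
by rewrite mulnCA mulrnA [X in K_le _ X]mulrnA; exact: K_le_mulrn.
Qed.

Lemma K_le0_of_mulrn a b k : (0 < k)%N -> K_le (a *+ k) (b *+ k) -> K_le0 a b.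
Proof.
case: k => // k _ ab m m0.
have [n mn] : exists n : nat, m <= n%:R.
  by exists (Num.bound m); apply/ltW/archi_boundP/ltW.
(* This number of rounds gives [n + 1 <= p / q]. *)
have [d [u [v [p [q [aE bE up /andP[p0 q0] pq]]]]]] :=
  iterated_matching (2 * k.+1 * n) ab.
exists u, d; split; [by rewrite addrC|exists p, q; split=> //|by exists v].
rewrite ler_pdivlMr ?ltr0n //.
apply: le_trans (_ : n%:R * q%:R <= _); first by rewrite ler_wpM2r ?ler0n.
by rewrite -natrM ler_nat; nia.
Qed.

End RefinementMonoids.

(** * The refinement property of [K_semi] *)

Section Refinement.
Variables (L : signature) (M : structure L) (I : isomorphisms M).

Local Open Scope classical_set_scope.

Local Notation pt i x := (i, existT (fun n : nat => n.-tuple M) _ x).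

(** The selector [Q] lets a single family of pieces serve both for a concatenation and for each of
    its two halves. *)
Definition decomposes (T : finType) (Q : pred T) (D : T -> defset M)
    (s : T -> nat) (X : seq (defset M)) : Prop :=
  [/\ forall t (x : (ddim (D t)).-tuple M),
        Q t -> dset x -> points X (pt (s t) x),
      forall z, points X z -> exists2 t, Q t &
        exists2 x : (ddim (D t)).-tuple M, dset x & z = pt (s t) x &
      forall t u (x : (ddim (D t)).-tuple M) (y : (ddim (D u)).-tuple M),
        Q t -> Q u -> dset x -> dset y -> pt (s t) x = pt (s u) y -> t = u].

Lemma K_class_map (T : Type) (D : T -> defset M) (r : seq T) :
  K_class I [seq D t | t <- r] = \sum_(t <- r) K_class I [:: D t].
Proof.
elim: r => [|t r IH]; first by rewrite big_nil.
by rewrite big_cons -IH K_classD.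
Qed.

(** Identity maps carry each selected piece to its own entry in the list of selected pieces. *)
Lemma K_class_sum (T : finType) (Q : pred T) (D : T -> defset M)
    (s : T -> nat) X :
  decomposes Q D s X -> K_class I X = \sum_(t | Q t) K_class I [:: D t].
Proof.
move=> [QX XQ DI]; rewrite -big_filter; set r := filter _ _.
have rQ t : (t \in r) = Q t by rewrite mem_filter mem_index_enum andbT.
have ur : uniq r by exact/filter_uniq/index_enum_uniq.
rewrite -K_class_map; apply/K_classP.
pose f := tnth (in_tuple r).
have nthD i : nth (defset0 M) [seq D t | t <- r] (nat_of_ord i) = D (f i).
  by rewrite (nth_map (f i)) // [in RHS]/f (tnth_nth (f i)).
have Qf i : Q (f i) by rewrite -rQ mem_tnth.
have fP t : Q t -> exists i, f i = t.
  by rewrite -rQ => /(tnthP (in_tuple r))[i ->]; exists i.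
exists 'I_(size r), (fun i => Piece (dset (d := D (f i))) id (s (f i)) i).
split.
- by move=> i; split; [exact: dsetP|exact: isom_id].
- move=> i j _ _ [_ [[/= x Dx <-] [/= y Dy e]]].
  have /esym/eqP := DI _ _ _ _ (Qf j) (Qf i) Dy Dx e.
  rewrite [in X in X == _]/f [in X in _ == X]/f !(tnth_nth (f i)).
  by rewrite nth_uniq // => /eqP/ord_inj.
- apply/seteqP; split=> [_ [i _ [/= x Dx <-]]|z /XQ[t /fP[i <-] [x Dx ->]]].
    exact: QX (Qf i) Dx.
  by exists i => //; exists x.
- by move=> i j _ _ [_ [[/= x Dx <-] [/= y Dy []]]] => /ord_inj.
- apply/seteqP; split=> [_ [i _ [/= x Dx <-]]|[i y]].
    by rewrite /points /= nthD; exists x.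
  (* Past the end, [nth] returns the empty [defset0], which has no points. *)
  have [lt|le] := ltnP i (size r); last first.
    by rewrite /points /= nth_default ?size_map // => -[].
  rewrite /points /= (nthD (Ordinal lt)) => -[x Dx ->].
  by exists (Ordinal lt) => //; exists x.
Qed.

Lemma points_catE (A B : seq (defset M)) i y : points (A ++ B) (i, y) =
  if (i < size A)%N then points A (i, y) else points B ((i - size A)%N, y).
Proof. by rewrite /points /= nth_cat; case: ifP. Qed.

Lemma points_size (A : seq (defset M)) i y :
  points A (i, y) -> (i < size A)%N.
Proof.
by rewrite /points /=; case: ltnP => // le; rewrite nth_default // => -[].
Qed.

(** A piece lies in a single component, so it never straddles [A] and [B]. *)
Lemma K_class_sum_cat (T : finType) (D : T -> defset M) (s : T -> nat) A B :
  decomposes predT D s (A ++ B) ->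
  K_class I A = \sum_(t | (s t < size A)%N) K_class I [:: D t] /\
  K_class I B = \sum_(t | ~~ (s t < size A)%N) K_class I [:: D t].
Proof.
move=> [DX XD DI]; split.
  apply: (@K_class_sum _ _ _ s); split.
  - by move=> t x lt Dx; have := DX t x isT Dx; rewrite points_catE lt.
  - move=> [i y] Ay; have lt := points_size Ay.
    have [|t _ [x Dx [e ->]]] := XD (i, y); first by rewrite points_catE lt.
    by exists t; rewrite -?e //; exists x; rewrite ?e.
  - by move=> t u x y _ _; exact: (DI t u x y isT isT).
apply: (@K_class_sum _ _ _ (fun t => s t - size A)%N); split.
- move=> t x /negbTE nlt Dx; have := DX t x isT Dx.
  by rewrite points_catE nlt.
- move=> [i y] By; have [|t _ [x Dx [e ->]]] := XD ((size A + i)%N, y).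
    by rewrite points_catE ltnNge leq_addr addKn.
  exists t; first by rewrite -e ltnNge leq_addr.
  by exists x; rewrite // -e addKn.
- move=> t u x y; rewrite -!leqNgt => lt lu Dx Dy xy.
  have [] := (congr1 fst xy, congr1 snd xy) => /= e exy.
  apply: (DI t u x y isT isT Dx Dy); rewrite exy.
  by rewrite -(subnK lt) e subnK.
Qed.

(** The pieces [P t] decompose [A ++ B] and their images [Q t] decompose [C ++ D]. Since [P t] and
    [Q t] have the same class, all four classes are subsums of one family, cut by [l] and by [r]. *)
Lemma K_semi_refinement : refinement (K_semi I).
Proof.
move=> a b c d.
have [A ->] := K_class_surj a; have [B ->] := K_class_surj b.
have [C ->] := K_class_surj c; have [D ->] := K_class_surj d.
rewrite !K_classD => /K_classP[T [p [ok tX dX tY dY]]].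
pose P t := Defset (ok t).1.
have dQ t : definable (Defs.pmap (p := p t) @` pset (p := p t)).
  by apply: definable_image (ok t).1; exact: isom_def (ok t).2.
pose Q t := Defset (dQ t).
have PQ t : K_class I [:: Q t] = K_class I [:: P t].
  apply/esym/K_class_simeq.
  exists unit, (fun _ => pset (p := p t)), (fun _ => Defs.pmap (p := p t)).
  split; [by move=> _; exact: ok|by move=> [] []| |by move=> [] []|];
    by apply/seteqP; split=> [x []|x]; [|exists tt].
have [|eA eB] := @K_class_sum_cat _ P (fun t => psrc (p t)) A B.
  split.
  - by move=> t x _ Px; rewrite -dX; exists t => //; exists x.
  - by move=> z; rewrite -dX => -[t _ [x Px <-]]; exists t => //; exists x.
  - move=> t u x y _ _ Px Py e; apply: tX => //.
    by exists (pt (psrc (p t)) x); split; [exists x|rewrite e; exists y].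
have [|eC eD] := @K_class_sum_cat _ Q (fun t => ptgt (p t)) C D.
  split.
  - move=> t _ _ [x Px <-]; rewrite -dY; exists t => //.
    by exists x.
  - move=> z; rewrite -dY => -[t _ [x Px <-]]; exists t => //.
    by exists (Defs.pmap x) => //; exists x.
  - move=> t u _ _ _ _ [x Px <-] [y Py <-] e; apply: tY => //.
    exists (pt (ptgt (p t)) (Defs.pmap x)).
    by split; [exists x|rewrite e; exists y].
pose l t := (psrc (p t) < size A)%N; pose r t := (ptgt (p t) < size C)%N.
exists (\sum_(t | l t && r t) K_class I [:: P t]),
  (\sum_(t | l t && ~~ r t) K_class I [:: P t]),
  (\sum_(t | ~~ l t && r t) K_class I [:: P t]),
  (\sum_(t | ~~ l t && ~~ r t) K_class I [:: P t]).
split.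
- by rewrite eA (bigID r).
- by rewrite eB (bigID r).
- rewrite eC (bigID l) /=; under eq_bigl do rewrite andbC.
  under [X in _ + X]eq_bigl do rewrite andbC.
  by congr (_ + _); apply: eq_bigr.
- rewrite eD (bigID l) /=; under eq_bigl do rewrite andbC.
  under [X in _ + X]eq_bigl do rewrite andbC.
  by congr (_ + _); apply: eq_bigr.
Qed.

End Refinement.

Theorem theorem5p2 (L : signature) (M : structure L) (I : isomorphisms M)
    (alpha beta : K_semi I) (k : nat) :
  (0 < k)%N -> K_le (alpha *+ k) (beta *+ k) -> K_le0 alpha beta.
Proof. exact/K_le0_of_mulrn/K_semi_refinement. Qed.
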